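(* Suppose that $(G,N,\theta)_{\mathcal H}\ge_c(H,M,\varphi)_{\mathcal H}$. Then there is an $\mathcal H$-equivariant bijection $\tau:\mathrm{Irr}(G|\theta^{\mathcal H})\to\mathrm{Irr}(H|\varphi^{\mathcal H})$ that preserves ratios of character degrees, i.e. $\chi(1)/\theta(1)=\tau(\chi)(1)/\varphi(1)$ for all $\chi$.
   Context: All groups are finite; $p$ is a fixed prime. $\mathbb Q^{\mathrm{ab}}\subseteq\mathbb C$ is generated by all roots of unity, $\mathcal G=\mathrm{Gal}(\mathbb Q^{\mathrm{ab}}/\mathbb Q)$, and $\mathcal H\le\mathcal G$ consists of those $\sigma$ for which there is an integer $f$ with $\sigma(\xi)=\xi^{p^f}$ for all roots of unity $\xi$ of order prime to $p$. For $N\trianglelefteq G$, $\theta\in\mathrm{Irr}(N)$, $g\in G$, $\sigma\in\mathcal G$: $\theta^{g\sigma}(n)=\sigma(\theta(gng^{-1}))$; $A_\theta$ is the stabilizer of $\theta$ in $A\le G\times\mathcal G$; $\theta^{\mathcal H}$ is the $\mathcal H$-orbit; $G_{\theta^{\mathcal H}}=\{g:\theta^g\in\theta^{\mathcal H}\}$; $\mathrm{Irr}(G|\theta^{\mathcal H})=\bigcup_{\sigma\in\mathcal H}\mathrm{Irr}(G|\theta^\sigma)$. $(G,N,\theta)_{\mathcal H}$ is an $\mathcal H$-triple if $N\trianglelefteq G$, $\theta\in\mathrm{Irr}(N)$ and $G_{\theta^{\mathcal H}}=G$. Projective representation $\mathcal P$ with factor set $\alpha$: $\mathcal P(x)\mathcal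 P(y)=\alpha(x,y)\mathcal P(xy)$. For $G$-invariant $\theta$, $\mathcal P$ (of $G$) is associated with $\theta$ if $\mathcal P_N$ is a representation affording $\theta$ and $\mathcal P(ng)=\mathcal P(n)\mathcal P(g)$, $\mathcal P(gn)=\mathcal P(g)\mathcal P(n)$ for $n\in N,g\in G$. $\mathcal Q\sim\mu\mathcal P$ means $\mathcal Q(x)=\mu(x)M^{-1}\mathcal P(x)M$ for all $x$, with $M$ fixed invertible. If $\mathcal P$ is a projective representation of $G_\theta$ associated with $\theta$ with entries in $\mathbb Q^{\mathrm{ab}}$ and $\theta^{x\sigma}=\theta$, set $\mathcal P^{x\sigma}(y)=\sigma(\mathcal P(xyx^{-1}))$ ($y\in G_\theta$, $\sigma$ entrywise), and let $\mu_{x\sigma}:G_\theta\to\mathbb C^\times$ be the unique function, constant on $N$-cosets with $\mu_{x\sigma}(1)=1$, such that $\mathcal P^{x\sigma}\sim\mu_{x\sigma}\mathcal P$. For $\mathcal H$-triples $(G,N,\theta)_{\mathcal H}$, $(H,M,\varphi)_{\mathcal H}$ with $H\le G$, $(G,N,\theta)_{\mathcal H}\ge_c(H,M,\varphi)_{\mathcal H}$ means: (i) $G=NH$, $N\cap H=M$, $\mathbf C_G(N)\subseteq H$; (ii) $(H\times\mathcal H)_\theta=(H\times\mathcal H)_\varphi$ (in particular $H_\theta=H_\varphi$); (iii) there are projective representations $\mathcal P$ of $G_\theta$ associated with $\theta$ and $\mathcal P'$ of $H_\varphi$ associated with $\varphi$, with entries in $\mathbb Q^{\mathrm{ab}}$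 and factor sets $\alpha,\alpha'$ taking root-of-unity values, with $\alpha=\alpha'$ on $H_\theta\times H_\theta$ and $\mathcal P(c)$, $\mathcal P'(c)$ equal to the same scalar for each $c\in\mathbf C_G(N)$; (iv) for every $a\in(H\times\mathcal H)_\theta$, $\mu_a$ (for $\mathcal P$) and $\mu'_a$ (for $\mathcal P'$) agree on $H_\theta$. *)

(* Defs.v *)
From HB Require Import structures.
From mathcomp Require Import all_boot all_order all_algebra all_fingroup all_solvable all_field all_character.
Unset Printing Implicit Defensive.
Import GRing.Theory Num.Theory.
Local Open Scope ring_scope.

(* Elements of Gal(Q^ab/Q) are represented by ring (auto)morphisms of algC;
   every such morphism restricts to an automorphism of Q^ab and every element
   of Gal(Q^ab/Q) arises this way.  Only the restriction to Q^ab matters below. *)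
Notation galC := {rmorphism algC -> algC}.

Definition p'root_unity (p : nat) (xi : algC) : Prop :=
  exists n : nat, [/\ (0 < n)%N, coprime n p & xi ^+ n = 1].

(* the subgroup \mathcal H: there is an integer f with sigma(xi) = xi^(p^f)
   for all roots of unity xi of order prime to p.  For f = k >= 0 this is the
   first disjunct; for f = -k < 0 it means sigma(xi)^(p^k) = xi.              *)
Definition inHcal (p : nat) (u : galC) : Prop :=
  exists k : nat,
    (forall xi, p'root_unity p xi -> u xi = xi ^+ (p ^ k)) \/
    (forall xi, p'root_unity p xi -> (u xi) ^+ (p ^ k) = xi).

Definition inQab (z : algC) : Prop :=
  exists (n : nat) (w : algC) (q : {poly rat}),
    n.-primitive_root w /\ z = (map_poly ratr q).[w].

Definition cfGal {gT : finGroupType} {N : {group gT}} (g : gT) (u : galC)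
  (theta : 'CF(N)) : 'CF(N) := cfAut u (theta ^ g)%CF.

Definition IrrOverOrbit (p : nat) {gT : finGroupType} (G N : {group gT})
  (theta : 'CF(N)) (chi : 'CF(G)) : Prop :=
  chi \in irr G /\
  exists u : galC, inHcal p u /\ '['Res[N] chi, cfAut u theta] != 0.

Definition Htriple (p : nat) {gT : finGroupType} (G N : {group gT})
  (theta : 'CF(N)) : Prop :=
  [/\ (N <| G)%g, theta \in irr N &
      forall g, g \in G -> exists u : galC, inHcal p u /\ (theta ^ g)%CF = cfAut u theta].

Definition assoc_proj {gT : finGroupType} (D : {group gT}) {N : {group gT}} (theta : 'CF(N))
  {n : nat} (P : gT -> 'M[algC]_n) (alpha : gT -> gT -> algC) : Prop :=
  [/\ (forall x, x \in D -> P x \in unitmx),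
      (forall x y, x \in D -> y \in D -> P x *m P y = alpha x y *: P (x * y)%g),
      [/\ P 1%g = 1%:M, (forall a b, a \in N -> b \in N -> P (a * b)%g = P a *m P b) &
          (forall a, a \in N -> \tr (P a) = theta a)],
      (forall a g, a \in N -> g \in D ->
          P (a * g)%g = P a *m P g /\ P (g * a)%g = P g *m P a) &
      ((forall x i j, x \in D -> inQab (P x i j)) /\
       (forall x y, x \in D -> y \in D -> exists k : nat, (0 < k)%N /\ alpha x y ^+ k = 1))].

(* mu is the function mu_{x sigma} for P: constant on N-cosets, mu(1) = 1,
   nonzero, and P^{x sigma} ~ mu P on D = G_theta,
   where P^{x sigma}(y) = sigma(P(x y x^-1)) (note y ^ x^-1 = x y x^-1). *)
Definition is_mu {gT : finGroupType} (D N : {group gT}) {n : nat}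
  (P : gT -> 'M[algC]_n) (x : gT) (u : galC) (mu : gT -> algC) : Prop :=
  [/\ (forall y, y \in D -> mu y != 0),
      (forall a y, a \in N -> y \in D -> mu (a * y)%g = mu y),
      mu 1%g = 1 &
      exists Mx : 'M[algC]_n, Mx \in unitmx /\
        forall y, y \in D ->
          map_mx u (P (y ^ x^-1)%g) = mu y *: (invmx Mx *m P y *m Mx)].

Definition central_order (p : nat) {gT : finGroupType} (G N H M : {group gT})
  (theta : 'CF(N)) (phi : 'CF(M)) : Prop :=
  [/\ [/\ Htriple p G N theta, Htriple p H M phi & (H \subset G)%g],
      [/\ (N * H)%g = G :> {set gT}, (N :&: H)%g = M :> {set gT} & ('C_G(N) \subset H)%g],
      (forall h u, h \in H -> inHcal p u ->
          (cfGal h u theta = theta <-> cfGal h u phi = phi)) &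
      exists (n m : nat) (P : gT -> 'M[algC]_n) (P' : gT -> 'M[algC]_m)
             (alpha alpha' : gT -> gT -> algC),
        [/\ assoc_proj ('I_G[theta])%G theta P alpha,
            assoc_proj ('I_H[phi])%G phi P' alpha',
            (forall x y, x \in ('I_H[theta])%g -> y \in ('I_H[theta])%g ->
                 alpha x y = alpha' x y),
            (forall c, c \in ('C_G(N))%g ->
                 exists lam : algC, P c = lam%:M /\ P' c = lam%:M) &
            (forall x u, x \in H -> inHcal p u -> cfGal x u theta = theta ->
               forall mu mu' : gT -> algC,
                 is_mu ('I_G[theta])%G N P x u mu ->
                 is_mu ('I_H[phi])%G M P' x u mu' ->
                 forall y, y \in ('I_H[theta])%g -> mu y = mu' y)]].

(* Main.v *)
Require Import Defs.
From HB Require Import structures.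
From mathcomp Require Import all_boot all_order all_algebra all_fingroup all_solvable all_field all_character.
From Stdlib Require Import ClassicalEpsilon.
Import GRing.Theory Num.Theory.
Local Open Scope ring_scope.

(* Put T = G_theta and S = H_phi, so that T = N S and N /\ S = M.  A character
   chi of T over theta is afforded by Q (x) P with Q a projective representation
   of T / N whose factor set is inverse to that of P.  As P and P' have the same
   factor set on S, Q restricted to S times P' is a representation of S, and
   chi |-> tr Q * tr P' is the correspondence Irr(T|theta) -> Irr(S|phi).  The
   orthogonality relations for P on the cosets of N give
     tr Q(y) = |N|^-1 sum_(a in N) chi(ay) tr(P(ay)^-1),
   so no Q has to be chosen.  The correspondence is an isometry because both
   inner products are averages of the same function on T / N = S / M, and it is
   onto because it maps Ind theta to Ind phi.  If (h, u) fixes theta, then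
   conjugating by it multiplies tr P by mu^-1 and tr Q by mu, and tr P' by the
   inverse of the same mu; so the correspondence commutes with (h, u).  The
   Clifford correspondences over theta and phi, and transport along the
   Hcal-orbit, extend it to G and H. *)

Set Implicit Arguments.
Unset Strict Implicit.

(** * Inverses of products, and scalars in Kronecker products *)

Section MatrixLemmas.

Variable F : fieldType.

Lemma invmxM n (A B : 'M[F]_n) :
  A \in unitmx -> B \in unitmx -> invmx (A *m B) = invmx B *m invmx A.
Proof.
move=> uA uB; have uAB : A *m B \in unitmx by rewrite unitmx_mul uA.
by rewrite -[RHS](mulKmx uAB) -[A *m B *m _]mulmxA (mulKVmx uB) mulmxV ?mulmx1.
Qed.

Lemma trow_scale n (a : F) (A : 'rV_n) m1 m2 (B : 'M_(m1, m2)) :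
  trow (a *: A) B = a *: trow A B.
Proof. by rewrite -!/(trowb B _) linearZ. Qed.

Lemma tprodZl m1 n1 (a : F) (A : 'M_(m1, n1)) m2 n2 (B : 'M_(m2, n2)) :
  tprod (a *: A) B = a *: tprod A B.
Proof.
elim: m1 n1 A => [|m1 IH] n1 A /=; first by rewrite scaler0.
by rewrite !linearZ /= trow_scale IH -scale_col_mx.
Qed.

Lemma tprodZr m1 n1 (a : F) (A : 'M_(m1, n1)) m2 n2 (B : 'M_(m2, n2)) :
  tprod A (a *: B) = a *: tprod A B.
Proof.
elim: m1 n1 A => [|m1 IH] n1 A /=; first by rewrite scaler0.
by rewrite linearZ IH -scale_col_mx.
Qed.

End MatrixLemmas.

(* If [chi] lies over [theta] then [chi = q * tr P], where [q] is the trace of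
   the projective representation of [G / N] with inverse factor set; the
   orthogonality relations for [P] on [N]-cosets recover [q] from [chi]. *)
Definition mult_trace (gT : finGroupType) (N : {set gT}) (n : nat)
    (P : gT -> 'M[algC]_n) (chi : gT -> algC) (y : gT) : algC :=
  #|N|%:R^-1 * \sum_(a in N) chi (a * y)%g * \tr (invmx (P (a * y)%g)).

(** * Schur's lemma and orthogonality for an associated projective representation *)

Section AssociatedProjectiveRepresentation.

Variables (gT : finGroupType) (D N : {group gT}) (theta : 'CF(N)) (n : nat).
Variables (P : gT -> 'M[algC]_n) (alpha : gT -> gT -> algC).
Hypotheses (irr_theta : theta \in irr N) (nsND : (N <| D)%g).
Hypothesis assocP : assoc_proj D theta P alpha.

Let sND : (N \subset D)%g := normal_sub nsND.

Lemma assoc_unit x : x \in D -> P x \in unitmx.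
Proof. by case: assocP => uP _ _ _ _; apply: uP. Qed.

Lemma assocMl a x : a \in N -> x \in D -> P (a * x)%g = P a *m P x.
Proof. by case: assocP => _ _ _ PM _ Na Dx; case: (PM a x Na Dx). Qed.

Lemma assocMr a x : a \in N -> x \in D -> P (x * a)%g = P x *m P a.
Proof. by case: assocP => _ _ _ PM _ Na Dx; case: (PM a x Na Dx). Qed.

Lemma assocV a : a \in N -> P a^-1%g = invmx (P a).
Proof.
move=> Na; have uPa := assoc_unit (subsetP sND a Na).
rewrite -[LHS](mulKmx uPa) -assocMl ?groupV ?(subsetP sND) //.
by rewrite mulgV; case: assocP => _ _ [-> _ _] _ _; rewrite mulmx1.
Qed.

Lemma assoc_mx_repr : mx_repr N P.
Proof.
case: assocP => _ _ [P1 PM _] _ _.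
by split=> // x y; apply: PM.
Qed.

Let rP := MxRepresentation assoc_mx_repr.

Lemma assoc_trace a : a \in N -> \tr (P a) = theta a.
Proof. by case: assocP => _ _ [_ _ trP] _ _; apply: trP. Qed.

Lemma cfRepr_assoc : cfRepr rP = theta.
Proof. by apply/cfun_inP=> a Na; rewrite cfunE Na mulr1n /= assoc_trace. Qed.

Lemma assoc_irr : mx_irreducible rP.
Proof.
have /irr_reprP[rG irr_rG defth] := irr_theta.
apply: mx_rsim_irr irr_rG; apply: cfRepr_inj.
by rewrite -defth cfRepr_assoc.
Qed.

Lemma assoc_dim : theta 1%g = n%:R.
Proof. by rewrite -cfRepr_assoc cfRepr1. Qed.

Lemma assoc_dim_neq0 : n%:R != 0 :> algC.
Proof. by rewrite -assoc_dim; have /irrP[i ->] := irr_theta; apply: irr1_neq0. Qed.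

Lemma assoc_cent X :
  (forall a, a \in N -> P a *m X = X *m P a) -> X = (n%:R^-1 * \tr X)%:M.
Proof.
move=> cPX; have /is_scalar_mxP[c ->] : is_scalar_mx X.
  apply: (mx_abs_irr_cent_scalar (rG := rP)); first exact/groupC/assoc_irr.
  by apply/centgmxP=> a Na; rewrite /= cPX.
by rewrite mxtrace_scalar -[c *+ n]mulr_natl mulKf ?assoc_dim_neq0.
Qed.

(** Reindexing by a translate in [N] shows that the sum commutes with every [P b], so it is scalar
    by Schur's lemma; each term has trace [\tr X], which gives the constant. *)
Lemma assoc_average X :
  \sum_(a in N) P a *m X *m invmx (P a) = (#|N|%:R / n%:R * \tr X)%:M.
Proof.
set Y := LHS; have -> : Y = (n%:R^-1 * \tr Y)%:M.
  apply: assoc_cent => b Nb; rewrite mulmx_sumr mulmx_suml.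
  rewrite (reindex_inj (mulgI b^-1)%g) /=; apply: eq_big => [a|a Na].
    by rewrite groupMl ?groupV.
  have Na' : a \in N by rewrite groupMl ?groupV in Na.
  rewrite assocMl ?groupV ?(subsetP sND) // assocV //.
  have [uPa uPb] : P a \in unitmx /\ P b \in unitmx.
    by rewrite !assoc_unit ?(subsetP sND).
  rewrite invmxM ?unitmx_inv // invmxK !mulmxA mulmxV // mul1mx.
  by rewrite -!mulmxA.
congr _%:M; rewrite raddf_sum /= (eq_bigr (fun=> \tr X)) => [|a Na].
  by rewrite sumr_const -[_ *+ #|_|]mulr_natl mulrA (mulrC n%:R^-1).
by rewrite mxtrace_mulC mulmxA mulVmx ?mul1mx // assoc_unit ?(subsetP sND).
Qed.

(* [tr U * tr V] is the sum over the matrix units [E_ij] of the [(i, j)]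
   entries of [U *m E_ij *m V], to which the averaging formula applies. *)
Lemma assoc_orthogonality y : y \in D ->
  \sum_(a in N) \tr (P (a * y)%g) * \tr (invmx (P (a * y)%g)) = #|N|%:R.
Proof.
move=> Dy; have uPy := assoc_unit Dy.
have trM (U V : 'M[algC]_n) :
    \tr U * \tr V = \sum_i \sum_j (U *m delta_mx i j *m V) i j.
  rewrite big_distrl; apply: eq_bigr => i _ /=; rewrite big_distrr /=.
  apply: eq_bigr => j _; rewrite -(mul_delta_mx (0 : 'I_1)) !mulmxA -colE.
  by rewrite -mulmxA -rowE mxE big_ord1 !mxE.
pose Z i j := P y *m delta_mx i j *m invmx (P y).
transitivity (\sum_i \sum_j (\sum_(a in N) P a *m Z i j *m invmx (P a)) i j).
  rewrite (eq_bigr (fun a => \sum_i \sum_j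
    (P a *m Z i j *m invmx (P a)) i j)) => [|a Na]; last first.
    rewrite trM; apply: eq_bigr => i _; apply: eq_bigr => j _.
    rewrite assocMl // invmxM ?assoc_unit ?(subsetP sND a Na) //.
    by rewrite /Z !mulmxA.
  rewrite exchange_big; apply: eq_bigr => i _; rewrite exchange_big.
  by apply: eq_bigr => j _; rewrite summxE.
transitivity (\sum_(i < n) \sum_(j < n) #|N|%:R / n%:R *+ (i == j) : algC).
  apply: eq_bigr => i _; apply: eq_bigr => j _; rewrite assoc_average mxE.
  rewrite /Z mxtrace_mulC mulmxA mulVmx // mul1mx.
  case: eqP => // <-; congr (_ *+ _).
  rewrite /mxtrace (bigD1 i) //= big1 => [|k ki]; rewrite !mxE ?eqxx ?addr0 ?mulr1 //.
  by rewrite (negPf ki).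
rewrite (eq_bigr (fun=> #|N|%:R / n%:R)) => [|i _].
  by rewrite sumr_const card_ord -[_ *+ n]mulr_natr divfK ?assoc_dim_neq0.
by rewrite (bigD1 i) //= eqxx big1 ?addr0 // => j /negPf; rewrite eq_sym => ->.
Qed.

Hypothesis invD : (D \subset 'I[theta])%g.

(* The class sum of [theta^-1] acts on a representation affording [chi] as the
   central idempotent of [theta], that is, as a scalar. *)
Lemma constt_average (i : Iirr D) y :
    '['Res[N] 'chi_i, theta] != 0 -> y \in D ->
  'chi_i y = n%:R / #|N|%:R * \sum_(a in N) \tr (invmx (P a)) * 'chi_i (a * y)%g.
Proof.
move=> th_i Dy; pose R := 'Chi_i; pose Z := \sum_(a in N) \tr (invmx (P a)) *: R a.
have [j def_th] := irrP irr_theta.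
have trV a : a \in N -> \tr (invmx (P a)) = theta a^-1%g.
  by move=> Na; rewrite -assocV // assoc_trace ?groupV.
(* Conjugation by [x] permutes [N] and preserves [theta], so [Z] commutes with [R x]. *)
have /is_scalar_mxP[c defZ] : is_scalar_mx Z.
  apply: (mx_abs_irr_cent_scalar (rG := R)); first exact/groupC/socle_irr.
  apply/centgmxP=> x Dx; have nNx := subsetP (normal_norm nsND) x Dx.
  rewrite mulmx_suml mulmx_sumr [RHS](reindex_inj (conjg_inj x)) /=.
  apply: eq_big => [a|a Na]; rewrite ?memJ_norm //.
  rewrite !trV ?memJ_norm // -conjVg inertia_valJ ?(subsetP invD) //.
  have Da := subsetP sND a Na.
  by rewrite -scalemxAl -scalemxAr -!repr_mxM ?groupJ // conjgC.
have trR x : x \in D -> \tr (R x) = 'chi_i x.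
  by move=> Dx; rewrite -irrRepr cfunE Dx.
have trZ x : x \in D -> \sum_(a in N) \tr (invmx (P a)) * 'chi_i (a * x)%g = c * 'chi_i x.
  move=> Dx; rewrite -trR // -mxtraceZ -mul_scalar_mx -defZ mulmx_suml raddf_sum /=.
  apply: eq_bigr => a Na; rewrite -scalemxAl mxtraceZ -repr_mxM ?(subsetP sND a Na) //.
  by rewrite trR ?groupM // (subsetP sND a Na).
have resN a : a \in N -> 'chi_i a = '['Res[N] 'chi_i, theta] * theta a.
  have i_j : j \in irr_constt ('Res[N] 'chi_i) by rewrite irr_consttE -def_th.
  move=> Na; rewrite -[LHS](cfResE _ sND Na) def_th.
  rewrite {1}(Clifford_Res_sum_cfclass nsND i_j).
  by rewrite cfclass_invariant -?def_th // big_seq1 cfunE.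
rewrite trZ //; suff -> : c = #|N|%:R / n%:R.
  by rewrite mulrA mulrA divfK ?neq0CG // mulfV ?assoc_dim_neq0 ?mul1r.
(* The identity element determines [c]: on [N] the character is a multiple of [theta], and
   orthogonality evaluates the sum. *)
have := trZ _ (group1 D).
rewrite resN // assoc_dim (eq_bigr (fun a => '['Res[N] 'chi_i, theta] *
    (\tr (P (a * 1)%g) * \tr (invmx (P (a * 1)%g))))) => [|a Na]; last first.
  by rewrite mulg1 resN // -assoc_trace // mulrC mulrA.
rewrite -mulr_sumr assoc_orthogonality // mulrCA => /(mulfI th_i) ->.
by rewrite mulfK ?assoc_dim_neq0.
Qed.

(** In [constt_average], replace [a] by [h a], where [h a * y] is the conjugate of [a * y] by
    [b^-1]. The value of ['chi_i] stays the same, while [invmx (P (a * y))] gets conjugated by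
    [P b]. Averaging over [b] makes that matrix scalar, and [\tr (P y)] splits off. *)
Lemma constt_factor (i : Iirr D) y :
    '['Res[N] 'chi_i, theta] != 0 -> y \in D ->
  'chi_i y = mult_trace N P 'chi_i y * \tr (P y).
Proof.
move=> th_i Dy; have nNy := subsetP (normal_norm nsND) y Dy.
have uPN a : a \in N -> P a \in unitmx by move=> /(subsetP sND)/assoc_unit.
have twist b : b \in N ->
    \sum_(a in N) \tr (invmx (P a)) * 'chi_i (a * y)%g
    = \sum_(a in N) 'chi_i (a * y)%g *
        \tr (P y *m (P b *m invmx (P (a * y)%g) *m invmx (P b))).
  move=> Nb; pose h a := (b * a * (b^-1 ^ y^-1))%g.
  have Nby : (b^-1 ^ y^-1)%g \in N by rewrite memJ_norm ?groupV.
  have inj_h : injective h by apply: inj_comp (mulIg _) (mulgI _).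
  rewrite (reindex_inj inj_h) /=; apply: eq_big => [a|a].
    by rewrite groupMr // groupMl.
  rewrite groupMr // groupMl // => Na.
  have def_h : (h a * y = (a * y) ^ b^-1)%g.
    by rewrite /h !conjgE !invgK !mulgA mulgKV.
  rewrite def_h cfunJ ?groupV ?(subsetP sND) // mulrC; congr (_ * \tr _).
  have Nha : h a \in N by rewrite groupMr // groupMl.
  have Day : (a * y)%g \in D by rewrite groupM // (subsetP sND).
  have Db := subsetP sND b Nb.
  have eqP : P (h a) *m P y = P b *m P (a * y)%g *m invmx (P b).
    rewrite -(assocMl Nha Dy) def_h conjgE invgK.
    rewrite (assocMl Nb) ?(assocMr _ Day) ?groupV ?assocV ?mulmxA //.
    by rewrite groupM ?groupV.
  have [uPy uPay] : P y \in unitmx /\ P (a * y)%g \in unitmx.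
    by rewrite !assoc_unit.
  have -> : P (h a) = P b *m P (a * y)%g *m invmx (P b) *m invmx (P y).
    by rewrite -eqP mulmxK.
  rewrite !invmxM ?unitmx_mul ?unitmx_inv ?uPay ?uPy ?(uPN _ Nb) //.
  by rewrite !invmxK !mulmxA.
rewrite (constt_average th_i Dy) /mult_trace; set S := (X in _ * X = _).
set Q := \sum_(a in N) 'chi_i _ * _.
suff defS : S = n%:R^-1 * (Q * \tr (P y)).
  by rewrite defS mulrACA mulfV ?assoc_dim_neq0 // mul1r mulrA.
apply: (mulfI (neq0CG N)); transitivity (\sum_(b in N) S).
  by rewrite sumr_const mulr_natl.
transitivity (\sum_(b in N) \sum_(a in N) 'chi_i (a * y)%g *
    \tr (P y *m (P b *m invmx (P (a * y)%g) *m invmx (P b)))).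
  by apply: eq_bigr => b; apply: twist.
rewrite exchange_big mulrA; set c := (X in _ = X * _).
transitivity (\sum_(a in N)
    'chi_i (a * y)%g * (c * \tr (invmx (P (a * y)%g)) * \tr (P y))).
  apply: eq_bigr => a Na; rewrite -mulr_sumr; congr (_ * _).
  rewrite -raddf_sum -mulmx_sumr assoc_average -scalemx1 /=.
  by rewrite -scalemxAr mulmx1 mxtraceZ.
move: c (\tr (P y)) => c t; rewrite mulr_suml mulr_sumr; apply: eq_bigr => a _.
by rewrite -!mulrA mulrCA.
Qed.

End AssociatedProjectiveRepresentation.

(** * Factor sets, averages over cosets, and characters cut out by idempotents *)

Section MoreAssociated.
Variables (gT : finGroupType) (D N : {group gT}) (theta : 'CF(N)) (n : nat).
Variables (P : gT -> 'M[algC]_n) (alpha : gT -> gT -> algC).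
Hypotheses (irr_theta : theta \in irr N) (nsND : (N <| D)%g).
Hypothesis assocP : assoc_proj D theta P alpha.

Let sND : (N \subset D)%g := normal_sub nsND.

Lemma assoc1 : P 1%g = 1%:M.
Proof. by case: assocP => _ _ []. Qed.

Lemma factor_neq0 x y : x \in D -> y \in D -> alpha x y != 0.
Proof.
move=> Dx Dy; case: assocP => _ _ _ _ [_ /(_ x y Dx Dy)[k [k_gt0 alphaX]]].
by apply: contra_eq_neq alphaX => ->; rewrite expr0n eqn0Ngt k_gt0 eq_sym oner_neq0.
Qed.

Lemma assocM x y : x \in D -> y \in D -> P (x * y)%g = (alpha x y)^-1 *: (P x *m P y).
Proof.
move=> Dx Dy; have ax0 := factor_neq0 Dx Dy.
by case: assocP => _ PM _ _ _; rewrite PM // scalerA mulVf ?scale1r.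
Qed.

Lemma invmx_assocM x y : x \in D -> y \in D ->
  invmx (P (x * y)%g) = alpha x y *: (invmx (P y) *m invmx (P x)).
Proof.
move=> Dx Dy; have ax0 := factor_neq0 Dx Dy.
have [uPx uPy] := (assoc_unit assocP Dx, assoc_unit assocP Dy).
rewrite assocM // invmxZ ?invrK ?invmxM //.
by rewrite unitmxZ ?unitfE ?invr_eq0 // unitmx_mul uPx.
Qed.

Lemma assoc_inv y : y \in D -> P y^-1%g = alpha y y^-1%g *: invmx (P y).
Proof.
move=> Dy; rewrite -[LHS](mulKmx (assoc_unit assocP Dy)).
case: assocP => _ PM _ _ _; rewrite PM ?groupV // mulgV assoc1.
by rewrite -scalemxAr mulmx1.
Qed.

(** [alpha y y^-1] is the scalar by which [P y *m P y^-1] acts, and passing from [y] to [a * y] only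
    conjugates this matrix by [P a]. *)
Lemma factor_inv_coset a y : a \in N -> y \in D ->
  alpha (a * y)%g (a * y)^-1%g = alpha y y^-1%g.
Proof.
have trI : \tr (1%:M : 'M[algC]_n) != 0.
  by rewrite mxtrace1 (assoc_dim_neq0 irr_theta assocP).
have def_alpha x : x \in D -> alpha x x^-1%g = \tr (P x *m P x^-1%g) / \tr (1%:M : 'M[algC]_n).
  move=> Dx; rewrite assoc_inv // -scalemxAr mulmxV ?(assoc_unit assocP) //.
  by rewrite mxtraceZ mulfK.
move=> Na Dy; have Da := subsetP sND a Na.
rewrite !def_alpha ?groupM // invMg (assocMr assocP (a := a^-1%g)) ?groupV //.
rewrite (assocMl assocP) // (assocV nsND assocP) // -mulmxA mxtrace_mulC.
by rewrite mulmxA mulmxKV ?(assoc_unit assocP).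
Qed.

Lemma mult_trace_coset (chi : gT -> algC) a y : a \in N ->
  mult_trace N P chi (a * y)%g = mult_trace N P chi y.
Proof.
move=> Na; congr (_ * _); rewrite [RHS](reindex_inj (mulIg a)) /=.
by apply: eq_big => [b|b _]; rewrite ?groupMr // mulgA.
Qed.

(** By orthogonality the weight [\tr (P y) * \tr (invmx (P y))] has mean 1 on each coset of [N], and
    [k] is constant there. *)
Lemma coset_average (k : gT -> algC) :
    (forall a y, a \in N -> y \in D -> k (a * y)%g = k y) ->
  \sum_(y in D) k y * (\tr (P y) * \tr (invmx (P y))) = \sum_(y in D) k y.
Proof.
move=> kN; apply: (mulfI (neq0CG N)).
transitivity (\sum_(a in N) \sum_(y in D) k (a * y)%g *
    (\tr (P (a * y)%g) * \tr (invmx (P (a * y)%g)))).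
  rewrite mulr_natl -sumr_const; apply: eq_bigr => a Na.
  rewrite (reindex_inj (mulgI a)) /=; apply: eq_bigl => y.
  by rewrite (groupMl _ (subsetP sND a Na)).
rewrite exchange_big mulr_sumr; apply: eq_bigr => y Dy /=.
rewrite -(assoc_orthogonality irr_theta nsND assocP Dy) mulr_suml.
by apply: eq_bigr => a Na; rewrite kN // mulrC.
Qed.

End MoreAssociated.

(** The character is that of the submodule spanned by the rows of [F]. With [B] a basis of the row
    space, [F] factors as [F *m C *m B] and [B *m F = B]; cyclicity of the trace does the rest. *)
Lemma idempotent_character (gT : finGroupType) (G : {group gT}) d
    (rG : mx_representation algC G d) (F : 'M_d) :
    F *m F = F -> {in G, forall x, F *m rG x = rG x *m F} ->
  exists2 chi : 'CF(G), chi \is a character &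
    {in G, forall x, chi x = \tr (F *m rG x)}.
Proof.
move=> FF cFG; have modF : mxmodule rG F.
  by apply/mxmoduleP=> x Gx; rewrite cFG // submxMl.
exists (cfRepr (submod_repr modF)); first exact: cfRepr_char.
move=> x Gx; rewrite cfunE Gx mulr1n /= /submod_mx.
set B := val_submod (1%:M : 'M_(\rank F)).
have BF : B *m F = B.
  by have /submxP[X ->] : (B <= F)%MS by [apply: val_submodP]; rewrite -mulmxA FF.
set C := in_submod F (1%:M : 'M_d).
have FCB : F = F *m C *m B.
  by rewrite -{1}[F](in_submodK (submx_refl F)) val_submodE in_submodE.
rewrite in_submodE -/C; transitivity (\tr (F *m C *m B *m rG x)); last by rewrite -FCB.
by rewrite -[in RHS]mulmxA [RHS]mxtrace_mulC !mulmxA -[B *m rG x *m F]mulmxA -cFG // mulmxA BF.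
Qed.

Lemma cfInd_invariant (gT : finGroupType) (D N : {group gT}) (theta : 'CF(N)) x :
    (N <| D)%g -> (D \subset 'I[theta])%g ->
  'Ind[D] theta x = #|D|%:R / #|N|%:R * theta x.
Proof.
move=> nsND invD; rewrite cfIndE ?normal_sub // [_ / _]mulrC -mulrA; congr (_ * _).
rewrite mulr_natl -sumr_const; apply: eq_bigr => y Dy.
by rewrite inertia_valJ ?(subsetP invD).
Qed.

(** * The correspondence over an invariant character *)

Section Transfer.
Variables (gT : finGroupType) (T N S M : {group gT}).
Variables (theta : 'CF(N)) (phi : 'CF(M)) (n m : nat).
Variables (P : gT -> 'M[algC]_n) (P' : gT -> 'M[algC]_m).
Variables alpha alpha' : gT -> gT -> algC.
Hypotheses (irr_theta : theta \in irr N) (irr_phi : phi \in irr M).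
Hypotheses (nsNT : (N <| T)%g) (nsMS : (M <| S)%g).
Hypotheses (defT : (N * S)%g = T) (defM : (N :&: S)%g = M).
Hypotheses (assocP : assoc_proj T theta P alpha) (assocP' : assoc_proj S phi P' alpha').
Hypothesis eq_alpha : {in S &, alpha =2 alpha'}.

Let sNT : (N \subset T)%g := normal_sub nsNT.
Let sST : (S \subset T)%g.
Proof. by rewrite -defT mulG_subr. Qed.
Let sMN : (M \subset N)%g.
Proof. by rewrite -defM subsetIl. Qed.

Let q := mult_trace N P.

(* If [R] affords [chi], then [J x U] is [X |-> P(x)^-1 X R(x)] on matrices,
   tensored with [U].  The projection [F] onto the [N]-fixed matrices commutes
   with [K = J _ P'], and its image is the tensor product of [Q] with [P']. *)
Lemma transfer_character (chi : 'CF(T)) : chi \is a character ->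
  exists2 psi : 'CF(S), psi \is a character &
    {in S, forall y, psi y = q chi y * \tr (P' y)}.
Proof.
case/char_reprP=> -[d rG] /= ->.
pose J x U := tprod (tprod (invmx (P x))^T (rG x)) U : 'M[algC]_(n * d * m).
have uP x : x \in T -> P x \in unitmx by move/(assoc_unit assocP).
have JMl a y U V : a \in N -> y \in T -> J a U *m J y V = J (a * y)%g (U *m V).
  move=> Na Ty; have Ta := subsetP sNT a Na.
  rewrite -!tprodE -trmx_mul -invmxM ?uP //.
  by rewrite -repr_mxM // -(assocMl assocP).
have JMr a y U V : a \in N -> y \in T -> J y V *m J a U = J (y * a)%g (V *m U).
  move=> Na Ty; have Ta := subsetP sNT a Na.
  rewrite -!tprodE -trmx_mul -invmxM ?uP //.
  by rewrite -repr_mxM // -(assocMr assocP).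
pose K y := J y (P' y).
have repK : mx_repr S K.
  split=> [|x y Sx Sy]; rewrite /K /J.
    by rewrite (assoc1 assocP) (assoc1 assocP') invmx1 trmx1 repr_mx1 !tprod1.
  have [Tx Ty] := (subsetP sST x Sx, subsetP sST y Sy).
  (* Inverting [P (x * y)] produces [alpha x y], and [P' (x * y)] produces the inverse of
     [alpha' x y]: the two cancel. *)
  rewrite -!tprodE -trmx_mul -invmxM ?uP // (assocM assocP') // (invmx_assocM assocP) //.
  rewrite linearZ /= !tprodZl tprodZr scalerA -eq_alpha //.
  rewrite mulfV ?(factor_neq0 assocP) // scale1r repr_mxM // invmxM ?uP //.
pose rK := MxRepresentation repK.
pose F := #|N|%:R^-1 *: \sum_(a in N) J a 1%:M.
have FJ y V : y \in T -> F *m J y V = #|N|%:R^-1 *: \sum_(a in N) J (a * y)%g V.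
  move=> Ty; rewrite -scalemxAl mulmx_suml; congr (_ *: _).
  by apply: eq_bigr => a Na; rewrite JMl // mul1mx.
have JF y V : y \in T -> J y V *m F = #|N|%:R^-1 *: \sum_(a in N) J (y * a)%g V.
  move=> Ty; rewrite -scalemxAr mulmx_sumr; congr (_ *: _).
  by apply: eq_bigr => a Na; rewrite JMr // mulmx1.
have FF : F *m F = F.
  rewrite {2}/F -scalemxAr mulmx_sumr; congr (_ *: _).
  transitivity (\sum_(b in N) F); last first.
    by rewrite sumr_const -scaler_nat scalerA mulfV ?neq0CG // scale1r.
  apply: eq_bigr => b Nb; rewrite FJ ?(subsetP sNT) //; congr (_ *: _).
  rewrite [RHS](reindex_inj (mulIg b)) /=; apply: eq_bigl => a.
  by rewrite groupMr.
have [|psi char_psi def_psi] := @idempotent_character _ _ _ rK F FF.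
  move=> y Sy; have Ty := subsetP sST y Sy; rewrite /= FJ // JF //; congr (_ *: _).
  rewrite (reindex_inj (conjg_inj y^-1%g)) /=; apply: eq_big => [a|a Na].
    by rewrite memJ_norm // groupV (subsetP (normal_norm nsNT)).
  by rewrite conjgE invgK mulgA mulgKV.
exists psi => // y Sy; have Ty := subsetP sST y Sy.
rewrite def_psi //= FJ // mxtraceZ raddf_sum /= /q /mult_trace -mulrA mulr_suml.
congr (_ * _); apply: eq_bigr => a Na; rewrite !mxtrace_prod mxtrace_tr.
by rewrite cfunE groupM ?(subsetP sNT a Na) // mulr1n [_ * \tr (rG _)]mulrC.
Qed.

Lemma transfer_card : (#|N| * #|S| = #|T| * #|M|)%N.
Proof. by rewrite mul_cardG defT defM. Qed.

(** Both sides are the mean of [k] over [T / N = S / M]. The proof counts in two ways the pairs of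
    an element of [T] and an element of [S] in the same coset of [N]. *)
Lemma coset_mean (k : gT -> algC) :
    (forall a y, a \in N -> y \in T -> k (a * y)%g = k y) ->
  #|T|%:R^-1 * \sum_(y in T) k y = #|S|%:R^-1 * \sum_(y in S) k y.
Proof.
(* This number also equals [|N| |S|], so it clears both denominators. *)
move=> kN; pose c := (#|T| * #|M|)%N%:R : algC.
have c0 : c != 0 by rewrite pnatr_eq0 -lt0n muln_gt0 !cardG_gt0.
apply: (mulfI c0); rewrite {2}/c -transfer_card /c !natrM.
rewrite mulrAC mulVKf ?neq0CG // -[RHS]mulrA mulVKf ?neq0CG //.
transitivity (\sum_(y in S) \sum_(x in T | (x * y^-1)%g \in N) k x); last first.
  rewrite mulr_sumr; apply: eq_bigr => y Sy; have Ty := subsetP sST y Sy.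
  rewrite (reindex_inj (mulIg y)) /= mulr_natl -sumr_const.
  apply: eq_big => [a|a]; rewrite mulgK; last by case/andP=> _ Na; rewrite kN.
  by rewrite andb_idl // => Na; rewrite groupM // (subsetP sNT).
rewrite (exchange_big_dep (mem T)) /= => [|y x _ /andP[] //].
rewrite mulr_suml; apply: eq_bigr => x Tx; rewrite sumr_const mulr_natr.
(* The elements of [S] in the [N]-coset of [x = a * s] form the [M]-coset of [s]. *)
congr (_ *+ _); have /mulsgP[a s Na Ss def_x] : x \in (N * S)%g by rewrite defT.
rewrite -(card_rcoset M s); apply: eq_card => y.
rewrite [RHS](_ : _ = (y \in S) && ((x * y^-1)%g \in N)); last first.
  by rewrite -[LHS]/[&& y \in S, x \in T & (x * y^-1)%g \in N] Tx.
rewrite mem_rcoset -defM !inE def_x -mulgA (groupMl _ Na) -(groupV N (s * _)%g) invMg invgK andbC.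
by rewrite (groupMr _ (groupVr Ss)).
Qed.

Hypothesis invT : (T \subset 'I[theta])%g.

Let over (i : Iirr T) := '['Res[N] 'chi_i, theta] != 0.
Let related (chi : 'CF(T)) (psi : 'CF(S)) :=
  {in S, forall y, psi y = q chi y * \tr (P' y)}.

(** ['['chi_i, 'chi_j]] is the mean over [T] of [k] weighted by [\tr (P y) * \tr (invmx (P y))],
    hence the mean of [k]. The same holds on [S] with [P'], and the two means of [k] agree. *)
Lemma transfer_isometry i j psi1 psi2 :
    over i -> over j ->
    psi1 \is a character -> psi2 \is a character ->
    related 'chi_i psi1 -> related 'chi_j psi2 ->
  '[psi1, psi2] = '['chi_i, 'chi_j].
Proof.
move=> th_i th_j ch1 ch2 def1 def2.
(* The factor [alpha y y^-1] comes from writing [P y^-1] as a multiple of [invmx (P y)]. *)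
pose k y := q 'chi_i y * (q 'chi_j y^-1%g * alpha y y^-1%g).
have kN a y : a \in N -> y \in T -> k (a * y)%g = k y.
  move=> Na Ty; have Na' : (a^-1 ^ y)%g \in N.
    by rewrite memJ_norm ?groupV // (subsetP (normal_norm nsNT)).
  rewrite /k (factor_inv_coset irr_theta nsNT assocP) // invMg.
  rewrite (_ : (y^-1 * a^-1)%g = ((a^-1 ^ y) * y^-1)%g); last first.
    by rewrite conjgE mulgA mulgK.
  by rewrite /q !mult_trace_coset.
rewrite !cfdotE; symmetry.
transitivity (#|T|%:R^-1 * \sum_(y in T) k y * (\tr (P y) * \tr (invmx (P y)))).
  congr (_ * _); apply: eq_bigr => y Ty.
  rewrite -irr_inv !(constt_factor irr_theta nsNT assocP invT) ?groupV //.
  rewrite (assoc_inv assocP) // mxtraceZ /k -/q.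
  by rewrite mulrACA [\tr _ * (alpha _ _ * _)]mulrCA !mulrA.
rewrite (coset_average irr_theta nsNT assocP kN) coset_mean //.
have sMS := normal_sub nsMS.
rewrite -(coset_average irr_phi nsMS assocP' (k := k)) => [|a y Ma Sy]; last first.
  by rewrite kN ?(subsetP sMN) ?(subsetP sST).
congr (_ * _); apply: eq_bigr => y Sy; rewrite -char_inv // def1 // def2 ?groupV //.
rewrite (assoc_inv assocP') // mxtraceZ /k eq_alpha ?groupV //.
by rewrite [RHS]mulrACA [\tr _ * (alpha' _ _ * _)]mulrCA !mulrA.
Qed.

Lemma mult_trace_cfInd y :
  q ('Ind[T] theta) y = if y \in N then #|T|%:R / #|N|%:R else 0.
Proof.
rewrite /q /mult_trace; case: ifP => Ny; last first.
  rewrite big1 ?mulr0 // => a Na; rewrite cfInd_invariant // cfun0 ?mulr0 ?mul0r //.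
  by rewrite groupMl ?Ny.
rewrite (eq_bigr (fun a => #|T|%:R / #|N|%:R *
    (\tr (P (a * y)%g) * \tr (invmx (P (a * y)%g))))) => [|a Na]; last first.
  by rewrite cfInd_invariant // -(assoc_trace assocP) ?groupM // mulrA.
rewrite -mulr_sumr (assoc_orthogonality irr_theta nsNT assocP) ?(subsetP sNT) //.
by rewrite mulrC mulfK ?neq0CG.
Qed.

Hypothesis invS : (S \subset 'I[phi])%g.

(** As [q] is linear in the character, the right side is [q ('Ind[T] theta) y * \tr (P' y)], that
    is, [|T| / |N|] times [phi] on [M] and zero elsewhere. This is ['Ind[S] phi] because
    [|T| / |N| = |S| / |M|]. *)
Lemma transfer_cfInd (t : Iirr T -> 'CF(S)) : (forall i, related 'chi_i (t i)) ->
  'Ind[S] phi = \sum_i '['Ind[T] theta, 'chi_i] *: t i.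
Proof.
move=> def_t; apply/cfun_inP=> y Sy; rewrite sum_cfunE.
transitivity (q ('Ind[T] theta) y * \tr (P' y)).
  rewrite mult_trace_cfInd cfInd_invariant //.
  have NM : (y \in N) = (y \in M) by rewrite -defM inE Sy andbT.
  case: ifP; rewrite NM => My; last by rewrite mul0r cfun0 ?mulr0 ?My.
  rewrite (assoc_trace assocP') //; congr (_ * _).
  apply: (mulIf (neq0CG N)); apply: (mulIf (neq0CG M)).
  rewrite divfK ?neq0CG // mulrAC divfK ?neq0CG // -!natrM -transfer_card.
  by rewrite mulnC.
rewrite /q /mult_trace {1}['Ind[T] theta]cfun_sum_cfdot -mulrA mulr_suml mulr_sumr.
rewrite (eq_bigr (fun a => \sum_i '['Ind[T] theta, 'chi_i] *
  (#|N|%:R^-1 * ('chi_i (a * y)%g * \tr (invmx (P (a * y)%g)) * \tr (P' y))))).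
  rewrite exchange_big; apply: eq_bigr => i _ /=; rewrite cfunE def_t //.
  by rewrite -mulr_sumr; congr (_ * _); rewrite -mulr_sumr -mulr_suml mulrA.
move=> a Na; rewrite sum_cfunE; move: (\tr (P' y)) (\tr (invmx _)) => b c.
rewrite !mulr_suml mulr_sumr; apply: eq_bigr => i _.
by rewrite cfunE; move: '[_, _] => e; rewrite -!mulrA mulrCA.
Qed.

(** Being isometric, the transfer sends characters over [theta] to distinct irreducible characters.
    The expansion of ['Ind[S] phi] in these shows that they lie over [phi] and that none is
    missed. *)
Theorem invariant_transfer : exists t : Iirr T -> Iirr S,
  [/\ {in over, forall i, related 'chi_i 'chi_(t i)},
      {in over, forall i, '['Res[M] 'chi_(t i), phi] != 0},
      {in over &, injective t} &
      forall j, '['Res[M] 'chi[S]_j, phi] != 0 -> exists2 i, over i & t i = j].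
Proof.
have /fin_all_exists[psi psiP] (i : Iirr T) : exists psi : 'CF(S),
    psi \is a character /\ related 'chi_i psi.
  by have [psi] := transfer_character (irr_char i); exists psi.
have ch_psi i : psi i \is a character by case: (psiP i).
have rel_psi i : related 'chi_i (psi i) by case: (psiP i).
have iso i j : over i -> over j -> '[psi i, psi j] = (i == j)%:R.
  by move=> th_i th_j; rewrite (transfer_isometry th_i th_j) ?cfdot_irr.
have overP i : ('['Ind[T] theta, 'chi_i] == 0) = ~~ over i.
  by rewrite -cfdot_Res_r cfdotC conjC_eq0 negbK.
have Ind_phi := transfer_cfInd rel_psi.
have /fin_all_exists[t def_t] (i : Iirr T) : exists j, over i -> 'chi_j = psi i.
  (* The index [0] is a filler for characters not over [theta]. *)
  case: (boolP (over i)) => th_i; last by exists 0.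
  have /irrP[j ->] : psi i \in irr S by rewrite irrEchar ch_psi iso ?eqxx.
  by exists j.
exists t; split=> [i th_i y Sy | i th_i | i j th_i th_j eq_t | j ph_j].
- by rewrite def_t // rel_psi.
- rewrite cfdot_Res_l def_t // cfdotC conjC_eq0 Ind_phi cfdot_suml (bigD1 i) //=.
  rewrite cfdotZl iso // eqxx mulr1 big1 ?addr0 ?overP ?negbK // => k ki.
  rewrite cfdotZl; case: (boolP (over k)) => th_k; last first.
    by move: th_k; rewrite -overP => /eqP ->; rewrite mul0r.
  by rewrite iso // (negPf ki) mulr0.
- apply/eqP; have := iso i j th_i th_j; rewrite -!def_t // eq_t cfdot_irr eqxx.
  by case: eqP => // _ /eqP; rewrite oner_eq0.
have : '['Ind[S] phi, 'chi_j] != 0.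
  by rewrite -cfdot_Res_r cfdotC conjC_eq0.
rewrite Ind_phi cfdot_suml => nz.
have [i nzi] : exists i, '['['Ind[T] theta, 'chi_i] *: psi i, 'chi_j] != 0.
  apply/existsP; apply: contraNT nz; rewrite negb_exists => /forallP z.
  by rewrite big1 // => i _; apply/eqP; rewrite -[_ == _]negbK z.
move: nzi; rewrite cfdotZl mulf_eq0 overP negb_or negbK => /andP[th_i].
rewrite -def_t // cfdot_irr; have [<- _|] := eqVneq (t i) j; last by rewrite eqxx.
by exists i.
Qed.

End Transfer.

(** * Galois action and the Clifford correspondence *)

Section Clifford.

Variables (gT : finGroupType) (G N : {group gT}) (a : Iirr N).
Hypothesis nsNG : (N <| G)%g.
Local Notation theta := 'chi_a.
Local Notation T := 'I_G[theta]%G.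
Implicit Types (i j : Iirr T) (w : galC).

Let over i := '['Res[N] 'chi_i, theta] != 0.

Let overE i : over i = (i \in irr_constt ('Ind[T] theta)).
Proof. by rewrite constt_Ind_Res irr_consttE. Qed.

(** This lemma and the next three restate the Clifford correspondence, with lying over [theta]
    expressed by restriction. *)
Lemma constt_Ind_irr i : over i -> 'Ind[G] 'chi_i \in irr G.
Proof. by rewrite overE; have [irrI _ _ _ _] := constt_Inertia_bijection a nsNG; apply: irrI. Qed.

Lemma constt_Ind_inj i j : over i -> over j -> 'Ind[G] 'chi_i = 'Ind[G] 'chi_j -> i = j.
Proof.
rewrite !overE => th_i th_j eqI; have [_ injI _ _ _] := constt_Inertia_bijection a nsNG.
by apply: injI => //; congr cfIirr.
Qed.

Lemma constt_Ind_surj (c : Iirr G) : '['Res[N] 'chi_c, theta] != 0 ->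
  exists2 i, over i & 'Ind[G] 'chi_i = 'chi_c.
Proof.
move=> th_c; have [_ _ defB _ _] := constt_Inertia_bijection a nsNG.
have: c \in irr_constt ('Ind[G] theta) by rewrite constt_Ind_Res irr_consttE.
rewrite -defB => /imsetP[i th_i ->]; rewrite -overE in th_i.
by exists i; rewrite // cfIirrE ?constt_Ind_irr.
Qed.

Lemma constt_Res_Ind i : over i -> '['Res[N] ('Ind[G] 'chi_i), theta] != 0.
Proof.
move=> th_i; have [_ _ _ _ eqI] := constt_Inertia_bijection a nsNG.
by rewrite -(eqI i) // -overE.
Qed.

(** Conjugating [T] by [x] gives the inertia group of [theta ^ x], and applying [w] to a character
    does not change its inertia group. *)
Lemma cfGal_inertia_norm x w :
  x \in G -> cfGal x w theta = theta -> x \in 'N(T)%g.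
Proof.
move=> Gx fix_th; have nNx := subsetP (normal_norm nsNG) x Gx.
apply/normP; rewrite /= conjIg conjGid // conjg_inertia //; congr (_ :&: _).
apply/setP=> y; rewrite !inE; apply: andb_id2l => nNy.
by rewrite -{3 4}fix_th /cfGal -cfAutConjg (inj_eq (@cfAut_inj _ _ _)).
Qed.

Definition galIirr w x i : Iirr T := aut_Iirr w (conjg_Iirr i x).

Lemma galIirrE w x i : 'chi_(galIirr w x i) = cfGal x w 'chi_i.
Proof. by rewrite aut_IirrE conjg_IirrE. Qed.

Lemma galIirr_over w x i : x \in G -> cfGal x w theta = theta ->
  over i -> over (galIirr w x i).
Proof.
move=> Gx fix_th th_i; have nNx := subsetP (normal_norm nsNG) x Gx.
have nTx := cfGal_inertia_norm Gx fix_th.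
rewrite /over galIirrE.
rewrite (_ : '[_, theta] = '['Res[N] (cfGal x w 'chi_i), cfGal x w theta]); last by rewrite fix_th.
rewrite /cfGal -cfAutRes -cfConjgRes_norm //.
rewrite cfdot_aut_char ?cfConjg_char ?irr_char // cfConjg_iso.
by rewrite fmorph_eq0.
Qed.

(** Conjugation by [x] in [G] is trivial on class functions of [G], so on induced characters the
    pair [(x, w)] acts as [w] alone. *)
Lemma cfAut_Ind_galIirr w x i : x \in G -> cfGal x w theta = theta ->
  cfAut w ('Ind[G] 'chi_i) = 'Ind[G] 'chi_(galIirr w x i).
Proof.
move=> Gx fix_th; have nTx := cfGal_inertia_norm Gx fix_th.
rewrite galIirrE /cfGal -cfAutInd -cfConjgInd_norm //; last exact: subsetP (normG G) x Gx.
by rewrite cfConjg_id.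
Qed.

(** Both [theta] and its image under [w] lie under the irreducible character ['Ind[G] 'chi_j], so
    they are [G]-conjugate by Clifford's theorem. *)
Lemma cfAut_Ind_cfGal w i j : over i -> over j ->
    cfAut w ('Ind[G] 'chi_i) = 'Ind[G] 'chi_j ->
  exists2 x, x \in G & cfGal x w theta = theta.
Proof.
move=> th_i th_j eqI; have /irrP[c def_c] := constt_Ind_irr th_j.
have a_c : a \in irr_constt ('Res[N] 'chi_c).
  by rewrite irr_consttE -def_c constt_Res_Ind.
have: '['Res[N] 'chi_c, cfAut w theta] != 0.
  rewrite -def_c -eqI -cfAutRes cfdot_aut_char ?irr_char // fmorph_eq0.
  exact: constt_Res_Ind.
rewrite (Clifford_Res_sum_cfclass nsNG a_c) cfdotZl mulf_eq0 negb_or => /andP[_].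
have [/cfclassP[x Gx def_w] _ | not_th] := boolP (cfAut w theta \in (theta ^: G)%CF).
  exists x^-1%g; rewrite ?groupV // /cfGal cfAutConjg def_w.
  by rewrite cfConjgK.
rewrite cfdot_suml big_seq big1 ?eqxx // => xi /cfclassP[x Gx def_xi].
rewrite def_xi -conjg_IirrE -aut_IirrE cfdot_irr; case: eqP => // eq_x.
by case/negP: not_th; rewrite -aut_IirrE -eq_x conjg_IirrE; apply/cfclassP; exists x.
Qed.

End Clifford.

(** * Conjugating a projective representation by a pair [(x, w)] *)

Section GaloisConjugation.

Variables (gT : finGroupType) (D N : {group gT}) (theta : 'CF(N)) (n : nat).
Variables (P : gT -> 'M[algC]_n) (alpha : gT -> gT -> algC).
Hypotheses (irr_theta : theta \in irr N) (nsND : (N <| D)%g).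
Hypothesis assocP : assoc_proj D theta P alpha.
Variables (x : gT) (w : galC).
Hypotheses (nNx : x \in 'N(N)%g) (nDx : x \in 'N(D)%g).

Let sND : (N \subset D)%g := normal_sub nsND.
Let Q y := map_mx w (P (y ^ x^-1)%g).

Let conjD y : y \in D -> (y ^ x^-1)%g \in D.
Proof. by move=> Dy; rewrite memJ_norm ?groupV. Qed.

Let conjN a : a \in N -> (a ^ x^-1)%g \in N.
Proof. by move=> Na; rewrite memJ_norm ?groupV. Qed.

Let Q_unit y : y \in D -> Q y \in unitmx.
Proof. by move=> Dy; rewrite map_unitmx (assoc_unit assocP) ?conjD. Qed.

Let Q_Ml a y : a \in N -> y \in D -> Q (a * y)%g = Q a *m Q y.
Proof.
by move=> Na Dy; rewrite /Q conjMg (assocMl assocP) ?conjN ?conjD // map_mxM.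
Qed.

Let Q_Mr a y : a \in N -> y \in D -> Q (y * a)%g = Q y *m Q a.
Proof.
by move=> Na Dy; rewrite /Q conjMg (assocMr assocP) ?conjN ?conjD // map_mxM.
Qed.

(** On [N] both [Q] and [P] afford [theta], so some [B] intertwines them. Then [X y], which compares
    [Q y] with [P y] through [B], commutes with [P] on [N] and is scalar by Schur's lemma; [mu y] is
    that scalar. Existence is needed to apply the compatibility condition, which quantifies over all
    such functions. *)
Lemma is_mu_exists : cfGal x w theta = theta -> exists mu, is_mu D N P x w mu.
Proof.
move=> fix_th; have Q1 : Q 1%g = 1%:M by rewrite /Q conj1g (assoc1 assocP) map_mx1.
have repQ : mx_repr N Q.
  by split=> // a b Na Nb; rewrite Q_Ml ?(subsetP sND).
pose rQ := MxRepresentation repQ.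
have eqQP : cfRepr rQ = cfRepr (MxRepresentation (assoc_mx_repr assocP)).
  apply/cfun_inP=> a Na; rewrite !cfunE Na !mulr1n /= /Q trace_map_mx.
  rewrite !(assoc_trace assocP) ?conjN // -[in RHS]fix_th !cfunE.
  by rewrite cfConjgE.
have [B _ freeB homB] := cfRepr_inj eqQP; rewrite /= in homB.
have uB : B \in unitmx by rewrite -row_free_unit.
have swapB a : a \in N -> invmx B *m Q a = P a *m invmx B.
  by move=> Na; rewrite -[LHS](mulmxK uB) -(mulmxA _ (Q a)) homB // mulKmx.
pose X y := invmx B *m Q y *m B *m invmx (P y).
have uP y (Dy : y \in D) : P y \in unitmx := assoc_unit assocP Dy.
have scalX y : y \in D -> X y = (n%:R^-1 * \tr (X y))%:M.
  move=> Dy; apply: (assoc_cent irr_theta assocP) => a Na.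
  have Da := subsetP sND a Na; have Nay : (a ^ y)%g \in N.
    by rewrite memJ_norm // (subsetP (normal_norm nsND)).
  have swapP : invmx (P y) *m P a = P (a ^ y)%g *m invmx (P y).
    have := congr1 P (conjgC a y).
    rewrite (assocMl assocP) // (assocMr assocP) // => eqP.
    by rewrite -[RHS](mulKmx (uP y Dy)) [P y *m (_ *m _)]mulmxA -eqP mulmxK ?uP.
  rewrite {1}/X !mulmxA -swapB // -(mulmxA _ (Q a)) -Q_Ml // conjgC Q_Mr //.
  rewrite /X -[RHS]mulmxA swapP !mulmxA -!(mulmxA _ (Q (a ^ y)%g)).
  by rewrite homB // !mulmxA.
pose mu y := n%:R^-1 * \tr (X y).
have defQ y : y \in D -> Q y = mu y *: (B *m P y *m invmx B).
  move=> Dy; have := scalX y Dy => /(congr1 (mulmx B)); rewrite /X !mulmxA mulmxV //.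
  rewrite mul1mx => /(congr1 (fun Z => Z *m P y *m invmx B)).
  by rewrite mulmxKV ?uP // mulmxK // mul_mx_scalar -!scalemxAl.
exists mu; split=> [y Dy|a y Na Dy||].
- apply: contraTneq (Q_unit Dy) => mu0; rewrite defQ // mu0 scale0r.
  rewrite -row_free_unit /row_free mxrank0; apply: contraNneq (assoc_dim_neq0 irr_theta assocP).
  by move=> <-.
- have Da := subsetP sND a Na; congr (_ * _); rewrite /X.
  rewrite Q_Ml // (assocMl assocP) // invmxM ?uP // !mulmxA swapB //.
  by rewrite mxtrace_mulC !mulmxA mulVmx ?uP // mul1mx.
- by rewrite /mu /X Q1 (assoc1 assocP) invmx1 mulmx1 mulmx1 mulVmx // mxtrace1 mulVf //
    (assoc_dim_neq0 irr_theta assocP).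
exists (invmx B); split=> [|y Dy]; first by rewrite unitmx_inv.
by rewrite invmxK -defQ.
Qed.

Variable mu : gT -> algC.
Hypothesis muP : is_mu D N P x w mu.

Lemma is_mu_trace y : y \in D -> w (\tr (P (y ^ x^-1)%g)) = mu y * \tr (P y).
Proof.
case: muP => _ _ _ [B [uB defQ]] Dy; rewrite -trace_map_mx defQ // mxtraceZ.
by rewrite mxtrace_mulC mulmxA mulmxV // mul1mx.
Qed.

(** Since [mult_trace] involves the inverse of [P], the factor [mu] appears on the side opposite to
    the one it has for [\tr (P y)]. *)
Lemma is_mu_mult_trace (chi : 'CF(D)) y : y \in D ->
  mult_trace N P (cfGal x w chi) y = mu y * w (mult_trace N P chi (y ^ x^-1)%g).
Proof.
case: muP => mu0 muN _ [B [uB defQ]] Dy; rewrite /mult_trace rmorphM fmorphV rmorph_nat.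
rewrite mulrCA; congr (_ * _); rewrite [in RHS](reindex_inj (conjg_inj x^-1%g)) /=.
rewrite rmorph_sum mulr_sumr; apply: eq_big => [a|a Na].
  by rewrite memJ_norm ?groupV.
have Da : a \in D by rewrite (subsetP sND).
rewrite -conjMg rmorphM /= !cfunE cfConjgE // mulrCA; congr (_ * _).
have uPay : P (a * y)%g \in unitmx by rewrite (assoc_unit assocP) ?groupM.
rewrite -trace_map_mx map_invmx defQ ?groupM // muN // invmxZ; last first.
  by rewrite unitmxZ ?unitfE ?mu0 // !unitmx_mul unitmx_inv uB uPay.
rewrite mxtraceZ mulVKf ?mu0 // !invmxM ?unitmx_mul ?unitmx_inv ?uB ?uPay //.
by rewrite invmxK [RHS]mxtrace_mulC -mulmxA mulmxV ?mulmx1.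
Qed.

End GaloisConjugation.

(** * The group structure of [inHcal] and its action on class functions *)

Section Hcal.

Variable p : nat.

Definition galC_id : galC := idfun.
Definition galC_comp (u v : galC) : galC := u \o v.
(** Endomorphisms of [algC] are invertible because they permute the roots of every rational
    polynomial. *)
Definition galC_inv (u : galC) : galC := algC_invaut u.

Lemma inHcal_id : inHcal p galC_id.
Proof. by exists 0%N; left=> xi _; rewrite expn0 expr1. Qed.

Lemma p'root_unity_gal (u : galC) xi : p'root_unity p xi -> p'root_unity p (u xi).
Proof.
by case=> k [k0 pk xik]; exists k; split=> //; rewrite -rmorphXn xik rmorph1.
Qed.

Lemma inHcal_inv u : inHcal p u -> inHcal p (galC_inv u).
Proof.
case=> k [] uE; exists k; [right | left] => xi xi_p'.
  by rewrite -uE ?algC_invautK //; apply: p'root_unity_gal.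
apply: (fmorph_inj u); rewrite /= algC_invautK rmorphXn uE //.
Qed.

(** The integer exponents add. When their signs differ, the smaller absolute value is subtracted
    from the larger, which decides the disjunct. *)
Lemma inHcal_comp u v : inHcal p u -> inHcal p v -> inHcal p (galC_comp u v).
Proof.
case=> k uE [l vE].
have pv xi := @p'root_unity_gal v xi.
have pX xi r : p'root_unity p xi -> p'root_unity p (xi ^+ r).
  by case=> s [s0 ps xis]; exists s; split=> //; rewrite exprAC xis expr1n.
case: uE vE => uE [] vE.
- exists (l + k)%N; left=> xi xi_p'.
  by rewrite /= vE // (uE _ (pX _ _ xi_p')) -exprM expnD.
- have [le_kl | /ltnW le_lk] := leqP k l; [exists (l - k)%N; right | exists (k - l)%N; left].
    move=> xi xi_p'; rewrite /= (uE _ (pv _ xi_p')) -exprM -expnD subnKC //.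
    exact: vE.
  move=> xi xi_p'; rewrite /= (uE _ (pv _ xi_p')) -[in LHS](subnKC le_lk) expnD exprM.
  by rewrite vE.
- have [le_kl | /ltnW le_lk] := leqP k l; [exists (l - k)%N; left | exists (k - l)%N; right].
    move=> xi xi_p'; rewrite /= vE // rmorphXn -[in LHS](subnKC le_kl) expnD exprM.
    by rewrite uE.
  move=> xi xi_p'; rewrite /= vE // rmorphXn -exprM -expnD subnKC //.
  exact: uE.
exists (l + k)%N; right=> xi xi_p'.
by rewrite /= addnC expnD exprM (uE _ (pv _ xi_p')) vE.
Qed.

End Hcal.

Section GaloisActionLemmas.

Variables (gT : finGroupType) (A : {group gT}).
Implicit Type chi : 'CF(A).

Lemma cfGalE x u chi y : x \in 'N(A)%g -> cfGal x u chi y = u (chi (y ^ x^-1)%g).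
Proof. by move=> nAx; rewrite cfunE cfConjgE. Qed.

Lemma cfAut_galC_id chi : cfAut galC_id chi = chi.
Proof. by apply/cfunP=> x; rewrite cfunE. Qed.

Lemma cfAut_galC_comp u v chi : cfAut (galC_comp u v) chi = cfAut u (cfAut v chi).
Proof. by apply/cfunP=> x; rewrite !cfunE. Qed.

Lemma cfAut_galC_inv u chi : cfAut u (cfAut (galC_inv u) chi) = chi.
Proof. exact: cfAutVK. Qed.

Lemma cfAut_galC_invl u chi : cfAut (galC_inv u) (cfAut u chi) = chi.
Proof. exact: cfAutK. Qed.

End GaloisActionLemmas.

Lemma IrrOverOrbit_cfAut (p : nat) (gT : finGroupType) (G N : {group gT}) (a : Iirr N)
    (u : galC) (chi : 'CF(G)) :
  inHcal p u -> IrrOverOrbit p G N 'chi_a chi -> IrrOverOrbit p G N 'chi_a (cfAut u chi).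
Proof.
move=> Hu [irr_chi [v [Hv chi_v]]]; split; first by rewrite cfAut_irr.
exists (galC_comp u v); split; first exact: inHcal_comp.
by rewrite cfAut_galC_comp -cfAutRes cfdot_aut_char ?cfAut_char ?irr_char // fmorph_eq0.
Qed.

(** * The correspondence over an orbit *)

Section Correspondence.

Variables (p : nat) (gT : finGroupType) (G N H M : {group gT}).
Variables (a : Iirr N) (b : Iirr M).
Local Notation theta := 'chi_a.
Local Notation phi := 'chi_b.
Local Notation T := 'I_G[theta]%G.
Local Notation S := 'I_H[phi]%G.
Hypotheses (nsNG : (N <| G)%g) (nsMH : (M <| H)%g) (sHG : (H \subset G)%g).
Hypotheses (defG : (N * H)%g = G) (defM : (N :&: H)%g = M).
Hypothesis stab_eq : forall h u, h \in H -> inHcal p u ->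
  (cfGal h u theta = theta <-> cfGal h u phi = phi).

Variables (n m : nat) (P : gT -> 'M[algC]_n) (P' : gT -> 'M[algC]_m).
Variables (alpha alpha' : gT -> gT -> algC).
Hypotheses (assocP : assoc_proj T theta P alpha) (assocP' : assoc_proj S phi P' alpha').
Hypothesis mu_eq : forall x u, x \in H -> inHcal p u -> cfGal x u theta = theta ->
  forall mu mu' : gT -> algC, is_mu T N P x u mu -> is_mu S M P' x u mu' ->
  forall y, y \in ('I_H[theta])%g -> mu y = mu' y.

Let sNG : (N \subset G)%g := normal_sub nsNG.
Let sMH : (M \subset H)%g := normal_sub nsMH.
Let nsNT : (N <| T)%g := normal_Inertia theta sNG.
Let nsMS : (M <| S)%g := normal_Inertia phi sMH.

(** This is the equality of stabilizers for the identity automorphism. *)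
Lemma inertia_eq : ('I_H[phi] = 'I_H[theta])%g.
Proof.
apply/setP=> y; rewrite !inE; apply: andb_id2l => Hy.
have nNy := subsetP (normal_norm nsNG) y (subsetP sHG y Hy).
have nMy := subsetP (normal_norm nsMH) y Hy.
move: nNy nMy; rewrite !inE => -> -> /=; have := stab_eq Hy (inHcal_id p).
rewrite /cfGal !cfAut_galC_id => eq_fix.
by apply/eqP/eqP=> /eq_fix.
Qed.

Lemma inertia_mul : (N * S)%g = T.
Proof.
by rewrite /= inertia_eq group_modl ?sub_inertia // defG.
Qed.

Lemma inertia_cap : (N :&: S)%g = M.
Proof. by rewrite /= setIA defM; apply/setIidPl/sub_inertia. Qed.

Let overT (i : Iirr T) := '['Res[N] 'chi_i, theta] != 0.
Let overS (j : Iirr S) := '['Res[M] 'chi_j, phi] != 0.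
Variable t : Iirr T -> Iirr S.
Hypothesis t_rel : {in overT, forall i,
  {in S, forall y, 'chi_(t i) y = mult_trace N P 'chi_i y * \tr (P' y)}}.
Hypothesis t_over : {in overT, forall i, overS (t i)}.
Hypothesis t_inj : {in overT &, injective t}.
Hypothesis t_surj : forall j, overS j -> exists2 i, overT i & t i = j.

Let sST : (S \subset T)%g.
Proof. by rewrite -inertia_mul mulG_subr. Qed.

(** Acting by [(x, w)] yields a factor [mu] from [mult_trace] on the left and a factor [mu'] from
    [\tr (P' y)] on the right; these agree by [mu_eq]. *)
Lemma transfer_gal x w i :
    x \in H -> inHcal p w -> cfGal x w theta = theta -> overT i ->
  t (galIirr w x i) = galIirr w x (t i).
Proof.
move=> Hx Hw fix_th th_i; have Gx := subsetP sHG x Hx.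
have fix_ph : cfGal x w phi = phi by apply/(stab_eq Hx Hw).
have nTx := cfGal_inertia_norm nsNG Gx fix_th.
have nSx := cfGal_inertia_norm nsMH Hx fix_ph.
have nNx := subsetP (normal_norm nsNG) x Gx.
have nMx := subsetP (normal_norm nsMH) x Hx.
have [mu muP] := is_mu_exists (mem_irr a) nsNT assocP nNx nTx fix_th.
have [mu' muP'] := is_mu_exists (mem_irr b) nsMS assocP' nMx nSx fix_ph.
apply: irr_inj; apply/cfun_inP=> y Sy; rewrite galIirrE.
have Ty := subsetP sST y Sy.
have Syx : (y ^ x^-1)%g \in S by rewrite memJ_norm ?groupV.
rewrite t_rel //; last exact: galIirr_over.
rewrite galIirrE (is_mu_mult_trace nsNT assocP nNx nTx muP) //.
rewrite cfGalE // t_rel // [RHS]rmorphM /= (is_mu_trace muP') //.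
rewrite (mu_eq Hx Hw fix_th muP muP') -?inertia_eq //.
by rewrite -mulrA mulrCA.
Qed.

(** Either equality provides an [x] in [H] such that [(x, w)] fixes [theta] and [phi]. It then says
    that [(x, w)] moves [i] to [j], respectively [t i] to [t j], and [t] is injective and commutes
    with this action. *)
Lemma transfer_cfAut_Ind w i j :
    inHcal p w -> overT i -> overT j ->
  cfAut w ('Ind[G] 'chi_i) = 'Ind[G] 'chi_j <->
  cfAut w ('Ind[H] 'chi_(t i)) = 'Ind[H] 'chi_(t j).
Proof.
move=> Hw th_i th_j; split=> eqI.
  have [x Hx fix_th] : exists2 x, x \in H & cfGal x w theta = theta.
    (* As [G = N H] and [N] fixes [theta], the conjugating element may be taken in [H]. *)
    have [g Gg fix_g] := cfAut_Ind_cfGal nsNG th_i th_j eqI.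
    move: (Gg); rewrite -{1}defG => /mulsgP[c h Nc Hh def_g].
    exists h => //; rewrite -{2}fix_g def_g /cfGal; congr cfAut.
    have [Gc Gh] := (subsetP sNG c Nc, subsetP sHG h Hh).
    by rewrite (cfConjgM _ nsNG Gc Gh) (cfConjg_id _ Nc).
  have Gx := subsetP sHG x Hx.
  have fix_ph : cfGal x w phi = phi by apply/(stab_eq Hx Hw).
  rewrite (cfAut_Ind_galIirr nsNG _ Gx fix_th) in eqI.
  have eq_ij := constt_Ind_inj nsNG (galIirr_over nsNG Gx fix_th th_i) th_j eqI.
  by rewrite (cfAut_Ind_galIirr nsMH _ Hx fix_ph) -transfer_gal // eq_ij.
have [th_ti th_tj] := (t_over th_i, t_over th_j).
have [x Hx fix_ph] := cfAut_Ind_cfGal nsMH th_ti th_tj eqI.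
have Gx := subsetP sHG x Hx.
have fix_th : cfGal x w theta = theta by apply/(stab_eq Hx Hw).
rewrite (cfAut_Ind_galIirr nsMH _ Hx fix_ph) -transfer_gal // in eqI.
have th_i' := galIirr_over nsNG Gx fix_th th_i.
rewrite (cfAut_Ind_galIirr nsNG _ Gx fix_th).
congr ('Ind[G] 'chi__); apply: t_inj => //.
by apply: (constt_Ind_inj nsMH) eqI => //; apply: t_over.
Qed.

(** A relation rather than a function, since several pairs [(u, i)] can describe the same [chi]. *)
Definition transferred (chi : 'CF(G)) (psi : 'CF(H)) : Prop :=
  exists (u : galC) (i : Iirr T),
    [/\ inHcal p u, overT i, chi = cfAut u ('Ind[G] 'chi_i)
      & psi = cfAut u ('Ind[H] 'chi_(t i))].

(** Moving [v] to the other side leaves the single automorphism [v^-1 u], covered by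
    [transfer_cfAut_Ind]. One direction makes the relation single-valued, the other makes it
    injective. *)
Lemma transferred_iff chi1 chi2 psi1 psi2 :
  transferred chi1 psi1 -> transferred chi2 psi2 -> (chi1 = chi2 <-> psi1 = psi2).
Proof.
case=> u [i [Hu th_i -> ->]] [v [j [Hv th_j -> ->]]].
have shift (A : {group gT}) (chi chi' : 'CF(A)) :
    cfAut u chi = cfAut v chi' <-> cfAut (galC_comp (galC_inv v) u) chi = chi'.
  rewrite cfAut_galC_comp; split=> [-> | <-]; first exact: cfAut_galC_invl.
  by rewrite cfAut_galC_inv.
have Hw := inHcal_comp (inHcal_inv Hv) Hu.
have iff_w := transfer_cfAut_Ind Hw th_i th_j.
by split=> /shift/iff_w/shift.
Qed.

Lemma transferred_cfAut u chi psi : inHcal p u ->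
  transferred chi psi -> transferred (cfAut u chi) (cfAut u psi).
Proof.
move=> Hu [v [i [Hv th_i -> ->]]]; exists (galC_comp u v), i.
by split; rewrite ?cfAut_galC_comp //; apply: inHcal_comp.
Qed.

Lemma transferred_over chi psi :
  transferred chi psi -> IrrOverOrbit p H M phi psi.
Proof.
case=> u [i [Hu th_i _ ->]]; have th_ti := t_over th_i.
have irrI := constt_Ind_irr nsMH th_ti.
split; first by rewrite cfAut_irr.
exists u; split=> //; rewrite -cfAutRes cfdot_aut_char ?irr_char // fmorph_eq0.
exact: constt_Res_Ind.
Qed.

(** Applying the inverse of [u] moves [chi] to a character over [theta] itself, where the Clifford
    correspondence applies. *)
Lemma transferred_total chi : IrrOverOrbit p G N theta chi -> exists psi, transferred chi psi.
Proof.
case=> /irrP[c ->] [u [Hu th_c]]; pose v := galC_inv u.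
have [|i th_i def_c] := @constt_Ind_surj _ _ _ a nsNG (aut_Iirr v c).
  apply: contraNneq th_c => eq0; rewrite -(cfAut_galC_inv u 'chi_c) -aut_IirrE.
  by rewrite -cfAutRes cfdot_aut_char ?irr_char // eq0 rmorph0.
exists (cfAut u ('Ind[H] 'chi_(t i))), u, i; split=> //.
by rewrite def_c aut_IirrE cfAut_galC_inv.
Qed.

Lemma transferred_surj psi : IrrOverOrbit p H M phi psi ->
  exists2 chi, IrrOverOrbit p G N theta chi & transferred chi psi.
Proof.
case=> /irrP[c ->] [u [Hu ph_c]]; pose v := galC_inv u.
have [|j ph_j def_c] := @constt_Ind_surj _ _ _ b nsMH (aut_Iirr v c).
  apply: contraNneq ph_c => eq0; rewrite -(cfAut_galC_inv u 'chi_c) -aut_IirrE.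
  by rewrite -cfAutRes cfdot_aut_char ?irr_char // eq0 rmorph0.
have [i th_i def_j] := t_surj ph_j.
have irrI := constt_Ind_irr nsNG th_i.
exists (cfAut u ('Ind[G] 'chi_i)); last first.
  by exists u, i; rewrite def_j def_c aut_IirrE cfAut_galC_inv.
split; first by rewrite cfAut_irr.
exists u; split=> //; rewrite -cfAutRes cfdot_aut_char ?irr_char // fmorph_eq0.
exact: constt_Res_Ind.
Qed.

(** The two ratios are [|G : T|] and [|H : S|] times the same value of [mult_trace] at 1. The
    indices agree because [|G| / |H| = |N| / |M| = |T| / |S|]. *)
Lemma transferred_degree chi psi : transferred chi psi ->
  chi 1%g / theta 1%g = psi 1%g / phi 1%g.
Proof.
case=> u [i [Hu th_i -> ->]].
have [sTG sSH] : (T \subset G /\ S \subset H)%g by rewrite !subsetIl.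
have deg (A B : {group gT}) (k : Iirr B) : (B \subset A)%g ->
    cfAut u ('Ind[A] 'chi_k) 1%g = #|A : B|%g%:R * 'chi_k 1%g.
  by move=> sBA; rewrite cfAut_char1 ?cfInd_char ?irr_char // cfInd1.
rewrite !deg // t_rel ?group1 // (constt_factor (mem_irr a) nsNT assocP) ?subsetIr //.
rewrite (assoc_trace assocP) // (assoc_trace assocP') //.
move: (mult_trace _ _ _ _) => q; rewrite !mulrA !mulfK ?irr1_neq0 //.
congr (_%:R * _); apply/eqP.
have card_GT := transfer_card inertia_mul inertia_cap.
have card_GH := transfer_card defG defM.
rewrite -(eqn_pmul2r (cardG_gt0 T)) -(eqn_pmul2r (cardG_gt0 M)).
rewrite [(#|G : T|%g * _)%N]mulnC Lagrange // -card_GH -mulnA -card_GT.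
by rewrite mulnCA [(#|H : S|%g * _)%N]mulnC Lagrange.
Qed.

End Correspondence.

(** * From the transfer relation to the equivariant bijection *)

Unset Implicit Arguments.
Set Strict Implicit.

Theorem theorem1p10 (p : nat) (gT : finGroupType) (G N H M : {group gT})
  (theta : 'CF(N)) (phi : 'CF(M)) :
  prime p ->
  central_order p G N H M theta phi ->
  exists tau : 'CF(G) -> 'CF(H),
    [/\ (forall chi, IrrOverOrbit p G N theta chi -> IrrOverOrbit p H M phi (tau chi)),
        (forall chi1 chi2, IrrOverOrbit p G N theta chi1 -> IrrOverOrbit p G N theta chi2 ->
            tau chi1 = tau chi2 -> chi1 = chi2),
        (forall psi, IrrOverOrbit p H M phi psi ->
            exists2 chi, IrrOverOrbit p G N theta chi & tau chi = psi),
        (forall (u : galC) chi, inHcal p u -> IrrOverOrbit p G N theta chi ->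
            tau (cfAut u chi) = cfAut u (tau chi)) &
        (forall chi, IrrOverOrbit p G N theta chi ->
            chi 1%g / theta 1%g = tau chi 1%g / phi 1%g)].
Proof.
move=> _ [[thG phH sHG] [defG defM _] stab_eq]; case: thG stab_eq => nsNG.
case/irrP=> a -> _ stab_eq; case: phH stab_eq => nsMH /irrP[b ->] _ stab_eq.
case=> n [m [P [P' [alpha [alpha' [assocP assocP' eq_alpha _ mu_eq]]]]]].
have eqI := inertia_eq nsNG nsMH sHG stab_eq.
have defT := inertia_mul nsNG nsMH sHG defG stab_eq.
have defS := inertia_cap b defM.
have [sNG sMH] := (normal_sub nsNG, normal_sub nsMH).
have eq_alphaS : {in 'I_H['chi_b]%G &, alpha =2 alpha'}.
  by move=> x y; rewrite /= eqI; apply: eq_alpha.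
have [t [t_rel t_over t_inj t_surj]] := invariant_transfer (mem_irr a) (mem_irr b)
  (normal_Inertia _ sNG) (normal_Inertia _ sMH) defT defS assocP assocP' eq_alphaS
  (subsetIr _ _) (subsetIr _ _).
pose R := transferred p t.
have R_iff chi1 chi2 psi1 psi2 : R chi1 psi1 -> R chi2 psi2 -> (chi1 = chi2 <-> psi1 = psi2).
  exact: (transferred_iff nsNG nsMH sHG defG stab_eq assocP assocP' mu_eq
    t_rel t_over t_inj).
(* For [chi] over the orbit some [psi] is related to [chi], and by [R_iff] only one; elsewhere the
   value is arbitrary. *)
pose tau chi := epsilon (inhabits 0) (R chi).
have tauP chi : IrrOverOrbit p G N 'chi_a chi -> R chi (tau chi).
  by move=> /(transferred_total nsNG t)/epsilon_spec; apply.
exists tau; split=> [chi /tauP | chi1 chi2 /tauP R1 /tauP R2 | psi | u chi Hu | chi /tauP].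
- exact: (transferred_over nsMH t_over).
- by case: (R_iff _ _ _ _ R1 R2).
- case/(transferred_surj nsNG nsMH t_surj)=> chi over_chi Rchi.
  by exists chi => //; case: (R_iff _ _ _ _ (tauP _ over_chi) Rchi) => ->.
- move=> over_chi; have Rchi := transferred_cfAut Hu (tauP _ over_chi).
  have Ruchi := tauP _ (IrrOverOrbit_cfAut Hu over_chi).
  by case: (R_iff _ _ _ _ Ruchi Rchi) => ->.
exact: (transferred_degree nsNG nsMH sHG defG defM stab_eq assocP assocP' t_rel).
Qed.
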